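(* There exist absolute positive constants $c$ and $c'$ such that the following holds. Let $B>2$ be an integer, and let $V$ be a linear code of dimension $k$, length $n$ and minimum relative distance $\delta$ over an arbitrary (finite or infinite) field $F$. If $m\ge c\frac{B^2k}{\delta}\log(B/\delta)$ and $V_m$ is a projection of $V$ on $m$ random coordinates, then with probability at least $1-e^{-c'\delta m/B^2}$ the dimension of $V_m$ is $k$ and its minimum distance is at least $\frac{B-1}{B+1}\delta m$.
   Context: A linear code of length $n$, dimension $k$ and minimum relative distance $\delta$ over $F$ is a $k$-dimensional subspace $V$ of $F^n$ in which every nonzero vector has at least $\delta n$ nonzero coordinates. A projection of $V$ on $m$ random coordinates is obtained by choosing a random multiset $I=(i_1,\dots,i_m)$ of coordinates, each $i_j$ chosen independently and uniformly from $[n]$ (with repetitions), and setting $V_m=\{(v_{i_1},\dots,v_{i_m}):v\in V\}\subseteq F^m$. The minimum distance of $V_m$ is the minimum number of nonzero coordinates of a nonzero vector of $V_m$. *)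

(* Defs.v *)
From HB Require Import structures.
From mathcomp Require Import all_boot all_order all_algebra.
From mathcomp Require Import boolp classical_sets reals constructive_ereal ereal.

Set Implicit Arguments.
Unset Strict Implicit.
Unset Printing Implicit Defensive.

Import Order.TTheory GRing.Theory Num.Theory.
Local Open Scope ring_scope.

Definition hamming_weight (F : fieldType) (n : nat) (v : 'rV[F]_n) : nat :=
  #|[set i : 'I_n | v 0 i != 0]|.

(* Minimum weight of a nonzero codeword; the value is +oo for the zero code,
   which has no nonzero codeword. *)
Definition min_distance (R : realType) (F : fieldType) (n : nat)
    (W : {vspace 'rV[F]_n}) : \bar R :=
  ereal_inf [set ((hamming_weight w)%:R)%:E
            | w in [set w : 'rV[F]_n | w \in W /\ w != 0]]%classic.

Definition linear_code (R : realType) (F : fieldType) (n k : nat) (delta : R)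
    (V : {vspace 'rV[F]_n}) : Prop :=
  \dim V = k /\
  forall v : 'rV[F]_n, v \in V -> v != 0 ->
    delta * n%:R <= (hamming_weight v)%:R.

(* [colsub I v] is the vector (v_(I 0), ..., v_(I (m - 1))). *)
Definition projection (F : fieldType) (n m : nat) (V : {vspace 'rV[F]_n})
    (I : {ffun 'I_m -> 'I_n}) : {vspace 'rV[F]_m} :=
  (linfun (fun v : 'rV[F]_n => colsub I v : 'rV[F]_m) @: V)%VS.

(* Probability of the event [E] when the coordinates I 0, ..., I (m - 1) are
   independent and uniform on 'I_n: the point I has mass (1/n) * ... * (1/n).
   This is a probability only for 0 < n. *)
Definition Pr_coords (R : realType) (n m : nat)
    (E : {ffun 'I_m -> 'I_n} -> Prop) : R :=
  \sum_(I : {ffun 'I_m -> 'I_n} | `[< E I >]) \prod_(j < m) (n%:R)^-1.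

(* Main.v *)
Require Import Defs.
From HB Require Import structures.
From mathcomp Require Import all_boot all_order all_algebra.
From mathcomp Require Import boolp classical_sets reals constructive_ereal ereal sequences exp.
From mathcomp Require Import ring lra.

(* If v is a nonzero codeword whose projection is too light, let Z be the set of
   samples j at which v vanishes. Some S inside Z with |S| <= k imposes on V the
   same linear conditions as Z, so the subcode U of V vanishing at the samples
   in S vanishes at all the samples in Z: fewer than (1 - 2 / (B + 1)) delta m
   samples meet the support of U. But U depends only on the samples in S, and its
   support contains that of v, hence has density at least delta. The other
   samples being independent of U, Chernoff's bound applies, and it remains to
   take the union over the at most (e m / k) ^ k sets S. *)

Set Implicit Arguments.
Unset Strict Implicit.
Unset Printing Implicit Defensive.

Import Order.TTheory GRing.Theory Num.Theory.
Local Open Scope ring_scope.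

(** * Supports and shortenings of codes *)

Section Codes.
Variables (F : fieldType) (n : nat).
Implicit Types (V : {vspace 'rV[F]_n}) (v : 'rV[F]_n).

Definition coordinate (i : 'I_n) : 'Hom('rV[F]_n, 'rV[F]_1) :=
  linfun (fun v : 'rV[F]_n => col i v : 'rV[F]_1).

Lemma coordinate_eq0 i v : (coordinate i v == 0) = (v 0 i == 0).
Proof.
rewrite lfunE /=; apply/eqP/eqP => [/matrixP/(_ 0 0)|v0]; first by rewrite !mxE.
by apply/matrixP => a b; rewrite !mxE !ord1.
Qed.

Definition code_support V : {set 'I_n} :=
  [set i | ~~ (V <= lker (coordinate i))%VS].

Lemma notin_code_support V v i : v \in V -> i \notin code_support V -> v 0 i = 0.
Proof.
rewrite inE negbK => vV /subvP /(_ _ vV).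
by rewrite memv_ker coordinate_eq0 => /eqP.
Qed.

Lemma hamming_weight_le_support V v :
  v \in V -> (hamming_weight v <= #|code_support V|)%N.
Proof.
move=> vV; apply/subset_leq_card/fintype.subsetP => i; rewrite inE; apply: contraR.
by move=> /(notin_code_support vV) ->.
Qed.

(** [S] consists of sample positions, not of coordinates: the union bound has to run over sets fixed
    before [I] is drawn. *)
Definition shortening m V (I : 'I_m -> 'I_n) (S : {set 'I_m}) :=
  (V :&: \bigcap_(j in S) lker (coordinate (I j)))%VS.

Lemma shortening_sub m V (I : 'I_m -> 'I_n) S : (shortening V I S <= V)%VS.
Proof. exact: capvSl. Qed.

Lemma mem_shortening m V (I : 'I_m -> 'I_n) (S : {set 'I_m}) v :
  v \in V -> (forall j, j \in S -> v 0 (I j) = 0) -> v \in shortening V I S.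
Proof.
move=> vV v0; rewrite memv_cap vV; apply/subv_bigcapP => j jS.
by rewrite -memvE memv_ker coordinate_eq0 v0.
Qed.

Lemma shortening_eq0 m V (I : 'I_m -> 'I_n) (S : {set 'I_m}) v j :
  v \in shortening V I S -> j \in S -> v 0 (I j) = 0.
Proof.
rewrite memv_cap => /andP[_ /subv_bigcapP v0] /v0.
by rewrite -memvE memv_ker coordinate_eq0 => /eqP.
Qed.

Lemma eq_shortening m V (I I' : 'I_m -> 'I_n) (S : {set 'I_m}) :
  {in S, I =1 I'} -> shortening V I S = shortening V I' S.
Proof. by move=> eqI; congr (_ :&: _)%VS; apply: eq_bigr => j /eqI ->. Qed.

(* A subset S of Z maximal for the condition dim + |S| <= dim V works, since
   adding a further j in Z cannot decrease the dimension. *)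
Lemma shortening_basis m V (I : 'I_m -> 'I_n) (Z : {set 'I_m}) :
  exists S : {set 'I_m}, [/\ S \subset Z, (#|S| <= \dim V)%N &
    forall j, j \in Z -> I j \notin code_support (shortening V I S)].
Proof.
pose P (S : {set 'I_m}) := (S \subset Z) && (\dim (shortening V I S) + #|S| <= \dim V)%N.
have P0 : P finset.set0.
  by rewrite /P finset.sub0set cards0 addn0 dimvS ?shortening_sub.
case: (@arg_maxnP _ finset.set0 P (fun S : {set 'I_m} => #|S|) P0) => S /andP[SZ dimS] maxS.
exists S; split=> // [|j jZ]; first exact: leq_trans (leq_addl _ _) dimS.
rewrite inE negbK; case jS: (j \in S).
  by apply/subvP => v vS; rewrite memv_ker coordinate_eq0 (shortening_eq0 vS).
set U := shortening V I S in dimS *; set K := lker _.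
have sUK : (shortening V I (j |: S) <= U :&: K)%VS.
  apply/subvP => v vS; rewrite memv_cap memv_ker coordinate_eq0.
  rewrite (shortening_eq0 vS) ?finset.setU11// eqxx andbT mem_shortening//.
    by rewrite (subvP (shortening_sub _ _ _) _ vS).
  by move=> i iS; rewrite (shortening_eq0 vS)// in_setU1 iS orbT.
apply/capv_idPl/eqP; rewrite eqEdim capvSl /= leqNgt; apply/negP => dimUK.
have := maxS (j |: S); rewrite cardsU1 jS /= add1n ltnn => /(_ _)/negP[]//.
rewrite /P finset.subUset finset.sub1set jZ SZ /= cardsU1 jS add1n addnS.
apply: leq_trans dimS; rewrite -addSn leq_add2r.
exact: leq_ltn_trans (dimvS sUK) dimUK.
Qed.

End Codes.

(** * Averages over random samples; counting small sets *)

Section Sampling.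
Variables (R : realType) (n m : nat).

Definition splice (S : {set 'I_m}) (I J : {ffun 'I_m -> 'I_n}) :=
  [ffun j => if j \in S then I j else J j].

(* The map (I, J) |-> (splice S I J, splice S J I) is an involution. *)
Lemma sum_splice (S : {set 'I_m}) (X : {ffun 'I_m -> 'I_n} -> R) :
  \sum_I \sum_J X (splice S I J) = (n ^ m)%:R * \sum_I X I.
Proof.
rewrite pair_big /=.
pose h (p : {ffun 'I_m -> 'I_n} * {ffun 'I_m -> 'I_n}) :=
  (splice S p.1 p.2, splice S p.2 p.1).
have hK : involutive h.
  by case=> I J; rewrite /h; congr pair; apply/ffunP => j; rewrite !ffunE; case: (j \in S).
rewrite (reindex_inj (inv_inj hK)) /=.
under eq_bigr => p _ do rewrite -[splice _ _ _]/((h (h p)).1) hK.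
rewrite -(pair_big xpredT xpredT (fun I _ => X I)) /= exchange_big /=.
by rewrite sumr_const card_ffun !card_ord mulr_natl.
Qed.

Lemma Pr_coordsE (E : {ffun 'I_m -> 'I_n} -> Prop) :
  Pr_coords R E = (n ^ m)%:R^-1 * \sum_(I | `[< E I >]) 1.
Proof.
rewrite mulr_sumr; apply: eq_bigr => I _.
by rewrite prodr_const card_ord mulr1 natrX exprVn.
Qed.

(** [X] dominates the indicator of the failure of [E], so its mean bounds the failure
    probability. *)
Lemma Pr_coords_markov (E : {ffun 'I_m -> 'I_n} -> Prop) X : (0 < n)%N ->
  (forall I, 0 <= X I) -> (forall I, ~ E I -> 1 <= X I) ->
  1 - (n ^ m)%:R^-1 * \sum_I X I <= Pr_coords R E.
Proof.
move=> n0 X0 X1; rewrite Pr_coordsE.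
have N0 : (n ^ m)%:R != 0 :> R by rewrite pnatr_eq0 -lt0n expn_gt0 n0.
rewrite -{1}(mulVf N0) -mulrBr ler_wpM2l ?invr_ge0 ?ler0n// lerBlDl.
have -> : (n ^ m)%:R = \sum_(I : {ffun 'I_m -> 'I_n}) 1 :> R.
  by rewrite sumr_const card_ffun !card_ord.
rewrite [leRHS]addrC [X in _ <= X + _]big_mkcond -big_split /=.
apply: ler_sum => I _; case: ifPn => [_|/asboolPn/X1 ?]; last by rewrite add0r.
by rewrite lerDl.
Qed.

End Sampling.

(** With x = k/m <= 1, each S of size at most k satisfies 1 <= x^|S| / x^k, and the sum of x^|S|
    over all S is (1 + x)^m <= e^(xm) = e^k. *)
Lemma sum_card_le (R : realType) (m k : nat) : (0 < k <= m)%N ->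
  \sum_(S : {set 'I_m} | (#|S| <= k)%N) (1 : R)
    <= expR (k%:R * (1 + ln (m%:R / k%:R))).
Proof.
move=> /andP[k0 km]; have m0 : (0 < m)%N by apply: leq_trans km.
have kR : 0 < k%:R :> R by rewrite ltr0n.
have mR : 0 < m%:R :> R by rewrite ltr0n.
pose x : R := k%:R / m%:R.
have x0 : 0 < x by rewrite divr_gt0.
have x1 : x <= 1 by rewrite ler_pdivrMr// mul1r ler_nat.
have -> : expR (k%:R * (1 + ln (m%:R / k%:R))) = expR x ^+ m * x ^- k.
  rewrite mulrDr mulr1 expRD expRM_natl -exprVn -(expRM_natl m) lnK ?posrE ?divr_gt0//.
  by rewrite /x invf_div [m%:R * (_ / _)]mulrC divfK// gt_eqF.
apply: (@le_trans _ _ ((x + 1) ^+ m * x ^- k)); last first.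
  rewrite ler_wpM2r ?invr_ge0 ?exprn_ge0 ?(ltW x0)//.
  by rewrite lerXn2r ?nnegrE ?expR_ge0 ?addr_ge0 ?(ltW x0)// addrC expR_ge1Dx.
rewrite -[in (x + 1) ^+ m](card_ord m) -prodr_const bigA_distr mulr_suml.
rewrite big_mkcond; apply: ler_sum => S _.
rewrite -big_mkcond /= prodr_const; case: ifP => Sk.
  rewrite ler_pdivlMr ?exprn_gt0// mul1r.
  by rewrite ler_wiXn2l// ltW.
by rewrite divr_ge0// exprn_ge0// ltW.
Qed.

(** * Exponential moments for a fixed set of positions *)

Section Chernoff.
Variables (R : realType) (F : fieldType) (n m : nat) (V : {vspace 'rV[F]_n}).
Variables (lambda theta : R).
Hypothesis lambda_ge0 : 0 <= lambda.

(* The exponential Markov bound for the event that the shortening of V at I(S)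
   is nonzero and fewer than theta sampled coordinates meet its support. *)
Definition chernoff_weight (S : {set 'I_m}) (I : {ffun 'I_m -> 'I_n}) : R :=
  let U := shortening V I S in
  if U == 0%VS then 0 else
  expR (lambda * theta) *
    \prod_(j | j \notin S) (if I j \in code_support U then expR (- lambda) else 1).

Lemma chernoff_weight_ge0 S I : 0 <= chernoff_weight S I.
Proof.
rewrite /chernoff_weight; case: ifP => // _; rewrite mulr_ge0 ?expR_ge0//.
by apply: prodr_ge0 => j _; case: ifP; rewrite ?expR_ge0.
Qed.

(** Apply [shortening_basis] to the zero positions Z of the projected v: positions in Z contribute
    the factor 1, the others at least e^(-lambda), and there are fewer than theta of these. *)
Lemma chernoff_weight_ge1 (I : {ffun 'I_m -> 'I_n}) v : v \in V -> v != 0 ->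
  (hamming_weight (colsub I v))%:R < theta ->
  exists2 S : {set 'I_m}, (#|S| <= \dim V)%N & 1 <= chernoff_weight S I.
Proof.
move=> vV vn0 lt_theta; pose Z := [set j | v 0 (I j) == 0].
have [S [SZ dimS suppS]] := shortening_basis V I Z.
exists S => //; rewrite /chernoff_weight.
have vS : v \in shortening V I S.
  by apply: mem_shortening => // j /(fintype.subsetP SZ); rewrite inE => /eqP.
case: eqVneq => [U0|_]; first by rewrite U0 memv0 (negPf vn0) in vS.
apply: (@le_trans _ _ (expR (lambda * theta) * expR (- lambda) ^+ #|~: Z|)).
  rewrite -[leLHS]expR0 -expRM_natl -expRD ler_expR mulrN mulrC -mulrBl mulr_ge0//.
  rewrite subr_ge0 ltW//; apply: le_lt_trans lt_theta.
  rewrite ler_nat /hamming_weight; apply/eq_leq/eq_card => j.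
  by rewrite !inE mxE.
rewrite ler_pM2l ?expR_gt0// -prodr_const big_mkcond [leRHS]big_mkcond /=.
have e1 : expR (- lambda) <= 1 by rewrite -expR0 ler_expR oppr_le0.
apply: ler_prod => j _; rewrite finset.in_setC; case: (boolP (j \in Z)) => jZ /=.
  by rewrite ler01 (negPf (suppS _ jZ)) if_same lexx.
by rewrite expR_ge0 /=; case: ifP => // _; case: ifP.
Qed.

(** Once the samples in S are fixed, so is the shortening; each of the m - |S| other samples hits
    its support with probability at least delta, so its factor has mean at most 1 - a <= e^(-a),
    where a = delta (1 - e^(-lambda)). *)
Lemma chernoff_weight_mean (delta : R) (S : {set 'I_m}) :
  (0 < n)%N ->
  (forall v, v \in V -> v != 0 -> delta * n%:R <= (hamming_weight v)%:R) ->
  (n ^ m)%:R^-1 * \sum_I chernoff_weight S I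
    <= expR (lambda * theta - delta * (1 - expR (- lambda)) * (m%:R - #|S|%:R)).
Proof.
move=> n0 dist; set a := delta * _.
have nR : 0 < n%:R :> R by rewrite ltr0n.
have N0 : 0 < (n ^ m)%:R :> R by rewrite ltr0n expn_gt0 n0.
set rhs := expR _; rewrite mulrC ler_pdivrMr//.
(* By [sum_splice] it suffices to freeze I on S and to redraw only the other samples, as J. *)
suff key I : \sum_J chernoff_weight S (splice S I J) <= (n ^ m)%:R * rhs.
  rewrite -(ler_pM2l N0) -(sum_splice S); apply: (le_trans (ler_sum _ (fun I _ => key I))).
  by rewrite sumr_const card_ffun !card_ord -[_ *+ (n ^ m)]mulr_natl [rhs * _]mulrC.
rewrite /chernoff_weight; set U := shortening V I S.
have eqU J : shortening V (splice S I J) S = U.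
  by apply: eq_shortening => j jS; rewrite ffunE jS.
under eq_bigr => J _ do rewrite eqU /=.
(* The zero subcode has empty support, so the density bound fails for it; its weight is 0 by
   definition. *)
have [U0|Un0] := eqVneq U 0%VS.
  by rewrite big1// mulr_ge0 ?ler0n ?expR_ge0.
rewrite -mulr_sumr.
(* Extending the product to all j, with factor 1 on S, lets the sum over J factor into sums over
   single coordinates. *)
pose g j i : R := if j \in S then 1
  else if i \in code_support U then expR (- lambda) else 1.
have -> : \sum_J \prod_(j | j \notin S)
      (if splice S I J j \in code_support U then expR (- lambda) else 1)
    = \sum_(J : {ffun 'I_m -> 'I_n}) \prod_j g j (J j).
  apply: eq_bigr => J _; rewrite big_mkcond; apply: eq_bigr => j _.
  by rewrite /g ffunE; case: (j \in S).
rewrite -(bigA_distr_bigA g) /=.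
have e1 : 0 <= 1 - expR (- lambda) by rewrite subr_ge0 -expR0 ler_expR oppr_le0.
have g_sum j : \sum_i g j i <= n%:R * (if j \in S then 1 else expR (- a)).
  rewrite /g; case: ifP => _; first by rewrite sumr_const card_ord mulr1.
  have -> : \sum_(i < n) (if i \in code_support U then expR (- lambda) else 1)
      = n%:R - #|code_support U|%:R * (1 - expR (- lambda)).
    rewrite (eq_bigr (fun i : 'I_n => 1 - (if i \in code_support U then
      1 - expR (- lambda) else 0))); last by move=> i _; case: ifP => _; ring.
    by rewrite sumrB sumr_const card_ord -big_mkcond /= sumr_const mulr_natl.
  have U_supp : delta * n%:R <= #|code_support U|%:R.
    have vU := memv_pick U; apply: (@le_trans _ _ (hamming_weight (vpick U))%:R).
      by rewrite dist ?vpick0// (subvP (shortening_sub V I S)).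
    by rewrite ler_nat hamming_weight_le_support.
  apply: (@le_trans _ _ (n%:R * (1 - a))).
    rewrite [leRHS]mulrBr mulr1 lerD2l lerN2 /a mulrA [n%:R * _]mulrC.
    exact: ler_wpM2r.
  by rewrite ler_pM2l// expR_ge1Dx.
apply: (@le_trans _ _ (expR (lambda * theta) *
    \prod_(j < m) (n%:R * (if j \in S then 1 else expR (- a))))).
  rewrite ler_pM2l ?expR_gt0//; apply: ler_prod => j _; rewrite g_sum andbT.
  apply: sumr_ge0 => i _; rewrite /g; case: ifP => // _.
  by case: ifP; rewrite ?expR_ge0.
rewrite big_split /= prodr_const card_ord -natrX mulrCA ler_pM2l//.
rewrite (eq_bigr (fun j => if j \in ~: S then expR (- a) else 1)); last first.
  by move=> j _; rewrite finset.in_setC; case: (j \in S).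
rewrite -big_mkcond /= prodr_const -expRM_natl -expRD /rhs ler_expR.
rewrite mulrN mulrC -[X in (X%:R - _)](card_ord m) -(cardsC S) natrD.
by rewrite [#|S|%:R + _]addrC addrK [a * _]mulrC.
Qed.

End Chernoff.

(** * Numerical estimates *)

Section Estimates.
Variable R : realType.
Implicit Types x b d k m : R.

Lemma ln_le_subr1 x : 0 < x -> ln x <= x - 1.
Proof. by move=> x0; have := expR_ge1Dx (ln x); rewrite lnK// => ?; lra. Qed.

(** With t = 1/(b + 1), the left side is at most d m (t (1 - 2t) - (t - t^2)(1 - t/2)) = - d m (t^2
    + t^3)/2, and (b + 1)^2 <= 2 b^2 for b >= 3. *)
Lemma chernoff_exponent b d k m s : 3 <= b -> 0 < d -> 0 <= m ->
  2 * (b + 1) * k <= m -> s <= k ->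
  (b + 1)^-1 * ((b - 1) / (b + 1) * d * m)
    - d * (1 - expR (- (b + 1)^-1)) * (m - s) <= - (d * m / (4 * b ^+ 2)).
Proof.
move=> b3 d0 m0 km sk; set t := (b + 1)^-1.
have b0 : 0 < b + 1 by lra.
have t0 : 0 < t by rewrite invr_gt0.
have tb : t * (b + 1) = 1 by rewrite mulVf// gt_eqF.
have t1 : t <= 1 by nra.
have -> : (b - 1) / (b + 1) = 1 - 2 * t by rewrite /t; field; rewrite gt_eqF.
(* From e^(-t) <= 1/(1 + t) <= 1 - t + t^2. *)
have et : t - t ^+ 2 <= 1 - expR (- t).
  have := expR_ge1Dx t; have := expR_gt0 (- t).
  have : expR (- t) * expR t = 1 by rewrite -expRD addNr expR0.
  set e := expR (- t); set f := expR t => ef e0 ft.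
  have : e * (1 + t) <= 1 by nra.
  have : 0 <= t ^+ 3 by rewrite exprn_ge0// ltW.
  nra.
have ms : m * (1 - t / 2) <= m - s by nra.
have t2 : 0 <= t - t ^+ 2 by nra.
have main : (t - t ^+ 2) * (m * (1 - t / 2)) <= (1 - expR (- t)) * (m - s).
  by apply: ler_pM => //; nra.
have tb2 : 1 / (4 * b ^+ 2) <= t ^+ 2 / 2.
  rewrite ler_pdivrMr; last nra.
  have : 1 = t ^+ 2 * (b + 1) ^+ 2 by rewrite -exprMn tb expr1n.
  have : 0 < t ^+ 2 by rewrite exprn_gt0.
  by nra.
have -> : d * m / (4 * b ^+ 2) = d * m * (1 / (4 * b ^+ 2)) by rewrite mul1r.
have dm : 0 <= d * m by rewrite mulr_ge0// ltW.
have t3 : 0 <= t ^+ 3 by rewrite exprn_ge0// ltW.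
have := ler_wpM2l (ltW d0) main; have := ler_wpM2l dm tb2.
by nra.
Qed.

(** The second bound makes the number of sets cost at most half of the Chernoff exponent d m / (4
    b^2). *)
Lemma sample_size_bounds b d k m : 3 <= b -> 0 < d <= 1 -> 0 < k ->
  100 * (b ^+ 2 * k / d) * ln (b / d) <= m ->
  2 * (b + 1) * k <= m /\ k * (1 + ln (m / k)) <= d * m / (8 * b ^+ 2).
Proof.
move=> b3 /andP[d0 d1] k0 km; set q := b / d in km.
have b0 : 0 < b by lra.
have q0 : 0 < q by rewrite divr_gt0.
have q3 : 3 <= q by rewrite ler_pdivlMr//; nra.
have qd : q * d = b by rewrite divfK// gt_eqF.
set L := ln q in km.
have L0 : 2 / 3 <= L.
  have := @ln_le_subr1 q^-1; rewrite invr_gt0 lnV ?posrE// => /(_ q0).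
  have : q^-1 <= 3^-1 by rewrite lef_pV2 ?posrE.
  by rewrite -/L; lra.
(* In the scale m = y A k, one has d m / (8 b^2) = k y, so the second claim becomes 1 + ln (y A) <=
   y. *)
pose A := 8 * b * q.
have A0 : 0 < A by rewrite /A; nra.
have [y m_eq] : exists y, m = y * A * k.
  by exists (m / k / A); rewrite divfK ?gt_eqF// divfK ?gt_eqF.
have yL : 12 * L <= y.
  have : 100 * (b * q * k) * L <= y * A * k.
    rewrite -m_eq; apply: le_trans km.
    by rewrite (_ : b ^+ 2 * k / d = b * q * k)// /q; ring.
  have -> : y * A * k = (b * q * k) * (8 * y) by rewrite /A; ring.
  have -> : 100 * (b * q * k) * L = (b * q * k) * (100 * L) by ring.
  by rewrite ler_pM2l ?(mulr_gt0 (mulr_gt0 b0 q0) k0)// => ?; lra.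
have y0 : 0 < y by lra.
split.
  rewrite m_eq ler_pM2r// /A; have : 24 <= y * q by nra.
  have -> : y * (8 * b * q) = 8 * b * (y * q) by ring.
  by nra.
have -> : d * m / (8 * b ^+ 2) = k * y.
  by rewrite m_eq /A -qd; field; rewrite !gt_eqF.
rewrite ler_pM2l// m_eq mulfK ?gt_eqF// lnM ?posrE//.
(* Indeed 8 b q <= 8 q^2 <= q^4. *)
have lnA : ln A <= 4 * L.
  rewrite mulr_natl -lnXn// ler_ln ?posrE ?exprn_gt0// /A.
  have : b <= q by nra.
  have : 9 <= q ^+ 2 by nra.
  nra.
(* This gives ln y <= y/2, as ln 2 <= 1; then 1 + y/2 + 4 L <= y follows from y >= 12 L and L >=
   2/3. *)
have := @ln_le_subr1 (y / 2); rewrite lnM ?posrE// lnV ?posrE// => /(_ (divr_gt0 y0 (ltr0n _ 2))).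
have := @ln_le_subr1 2; rewrite ltr0n => /(_ isT).
lra.
Qed.

End Estimates.

(** * Projected codes and the final assembly *)

Lemma mem_projection (F : fieldType) (n m : nat) (V : {vspace 'rV[F]_n})
    (I : {ffun 'I_m -> 'I_n}) w :
  w \in projection V I -> exists2 v, v \in V & w = colsub I v.
Proof. by case/memv_imgP => v vV ->; exists v => //; rewrite lfunE. Qed.

Lemma dim_projection (F : fieldType) (n m : nat) (V : {vspace 'rV[F]_n})
    (I : {ffun 'I_m -> 'I_n}) :
  (forall v, v \in V -> v != 0 -> colsub I v != 0) ->
  \dim (projection V I) = \dim V.
Proof.
move=> inj; apply: limg_dim_eq; apply/eqP; rewrite -subv0; apply/subvP => v.
rewrite memv_cap memv_ker lfunE /= memv0 => /andP[vV].
by apply: contraTT => /(inj _ vV).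
Qed.

Lemma hamming_weight0 (F : fieldType) (n : nat) :
  hamming_weight (0 : 'rV[F]_n) = 0%N.
Proof. by apply: eq_card0 => i; rewrite !inE mxE eqxx. Qed.

(** As theta is positive, the weight bound also forces the projection to be injective on V. *)
Lemma projection_good (R : realType) (F : fieldType) (n m : nat)
    (V : {vspace 'rV[F]_n}) (I : {ffun 'I_m -> 'I_n}) (theta : R) :
  0 < theta ->
  (forall v, v \in V -> v != 0 -> theta <= (hamming_weight (colsub I v))%:R) ->
  \dim (projection V I) = \dim V /\ (theta%:E <= min_distance R (projection V I))%E.
Proof.
move=> theta0 wt; split.
  apply: dim_projection => v vV vn0; apply: contraTneq (wt v vV vn0) => ->.
  by rewrite hamming_weight0 -ltNge.
apply: le_ereal_inf_tmp => _ [w [/mem_projection[v vV ->] vn0] <-].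
rewrite lee_fin wt//; apply: contraNneq vn0 => ->; apply/eqP/matrixP => i j.
by rewrite !mxE.
Qed.

Lemma relative_distance_le1 (R : realType) (F : fieldType) (n k : nat)
    (delta : R) (V : {vspace 'rV[F]_n}) :
  (0 < n)%N -> (0 < k)%N -> linear_code k delta V -> delta <= 1.
Proof.
move=> n0 k0 [dimV dist]; have Vn0 : vpick V != 0.
  by rewrite vpick0 -dimv_eq0 dimV -lt0n.
rewrite -(@ler_pM2r _ n%:R) ?ltr0n// mul1r.
apply: le_trans (dist _ (memv_pick V) Vn0) _.
by rewrite ler_nat -[leqRHS]card_ord max_card.
Qed.

Theorem theorem6p4 (R : realType) :
  exists c c' : R, 0 < c /\ 0 < c' /\
    forall (B : nat) (F : fieldType) (n k m : nat) (delta : R)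
           (V : {vspace 'rV[F]_n}),
      (2 < B)%N -> (0 < n)%N -> 0 < delta ->
      linear_code k delta V ->
      c * (B%:R ^+ 2 * k%:R / delta) * ln (B%:R / delta) <= m%:R ->
      1 - expR (- (c' * delta * m%:R / B%:R ^+ 2))
        <= Pr_coords R (fun I : {ffun 'I_m -> 'I_n} =>
             \dim (projection V I) = k /\
             (((B%:R - 1) / (B%:R + 1) * delta * m%:R)%:E
                <= min_distance R (projection V I))%E).
Proof.
exists 100, 8^-1; split; first by rewrite ltr0n.
split=> [|B F n k m delta V B2 n0 d0 code large]; first by rewrite invr_gt0 ltr0n.
have [dimV dist] := code.
set theta := (_ / (_ + 1) * delta * m%:R : R).
(* For k = 0 nothing bounds delta by 1, but the event is certain: the projected code is zero and its
   minimum distance is +oo. *)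
have [k0|k0] := posnP k.
  have V0 v : v \in V -> v = 0.
    have -> : V = 0%VS by apply/eqP; rewrite -dimv_eq0 dimV k0.
    by rewrite memv0 => /eqP.
  apply: le_trans (Pr_coords_markov (X := fun=> 0) n0 _ _) => // [|I []].
    by rewrite big1// mulr0 subr0 lerBlDr lerDl expR_ge0.
  split.
    rewrite -dimV; apply: dim_projection => v /V0 ->.
    by rewrite eqxx.
  apply: le_ereal_inf_tmp => _ [w [/mem_projection[v /V0 -> ->]]] /eqP[].
  by apply/matrixP => i j; rewrite !mxE.
have B3 : 3 <= B%:R :> R by rewrite ler_nat.
have kR : 0 < k%:R :> R by rewrite ltr0n.
have d1 : delta <= 1 by apply: relative_distance_le1 code.
have [km count] := @sample_size_bounds R _ _ _ _ B3 (introT andP (conj d0 d1)) kR large.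
have m0 : 0 < m%:R :> R by nra.
have theta0 : 0 < theta by rewrite /theta !mulr_gt0 ?invr_gt0//; lra.
set l : R := (B%:R + 1)^-1.
have l0 : 0 <= l by rewrite invr_ge0; lra.
pose X (I : {ffun 'I_m -> 'I_n}) :=
  \sum_(S : {set 'I_m} | (#|S| <= k)%N) chernoff_weight V l theta S I.
have X0 I : 0 <= X I by apply: sumr_ge0 => S _; apply: chernoff_weight_ge0.
apply: le_trans (Pr_coords_markov n0 X0 _); last first.
  move=> I; apply: contra_notP => X1; rewrite -dimV.
  apply: (projection_good theta0) => v vV vn0; rewrite leNgt; apply/negP => bad.
  have [S Sk S1] := chernoff_weight_ge1 l0 vV vn0 bad; apply: X1.
  rewrite /X (bigD1 S) -?dimV//= (le_trans S1)// lerDl.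
  by apply: sumr_ge0 => T _; apply: chernoff_weight_ge0.
rewrite lerD2l lerN2 /X exchange_big mulr_sumr /=.
set u := delta * m%:R / (4 * B%:R ^+ 2).
apply: (@le_trans _ _ (\sum_(S : {set 'I_m} | (#|S| <= k)%N) 1 * expR (- u))).
  apply: ler_sum => S Sk; rewrite mul1r.
  apply: le_trans (chernoff_weight_mean _ l0 S n0 dist) _; rewrite ler_expR.
  by apply: chernoff_exponent km _; rewrite ?ler_nat// ltW.
rewrite -mulr_suml.
apply: (@le_trans _ _ (expR (k%:R * (1 + ln (m%:R / k%:R))) * expR (- u))).
  rewrite ler_wpM2r ?expR_ge0// sum_card_le// k0 -(ler_nat R).
  by nra.
(* The exponent is at most u/2 - u = - u/2, whence c' = 1/8. *)
rewrite -expRD ler_expR; apply: le_trans (lerD count (lexx _)) _.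
rewrite le_eqVlt /u; apply/orP; left; apply/eqP; field.
by rewrite gt_eqF//; lra.
Qed.
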